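(* Let $(M,\alpha_M)$ be an ideal of a perfect Hom-Lie algebra $(L,\alpha_L)$. Then there is an exact sequence of vector spaces $$\operatorname{Ker}\big(M\star L\overset{\psi_{M}}{\longrightarrow} M\big)\to H_2^{\alpha}(L)\to H_2^{\alpha}(L/M)\to M/[L,M]\to 0.$$
   Context: All vector spaces, linear maps, tensor and exterior products are over a fixed field $\mathbb{K}$. A Hom-Lie algebra $(L,\alpha_L)$ is a vector space $L$ with a bilinear product $[-,-]$ and a linear map $\alpha_L:L\to L$ such that $[x,y]=-[y,x]$, $[\alpha_L(x),[y,z]]+[\alpha_L(z),[x,y]]+[\alpha_L(y),[z,x]]=0$ and (multiplicativity, always assumed) $\alpha_L[x,y]=[\alpha_L(x),\alpha_L(y)]$ for all $x,y,z\in L$. An ideal $(M,\alpha_M)$ of $(L,\alpha_L)$ is a subspace $M$ with $\alpha_L(M)\subseteq M$, $\alpha_M=\alpha_L|_M$, and $[x,y]\in M$ for all $x\in M$, $y\in L$; then $L/M$ is a Hom-Lie algebra with the induced product and endomorphism. $[L,M]$ is the subspace spanned by all $[l,m]$, $l\in L$, $m\in M$. $(L,\alpha_L)$ is perfect if $L=[L,L]$. A Hom-action of $(L,\alpha_L)$ on $(M,\alpha_M)$ is a linear map $L\otimes M\to M$, $x\otimes m\mapsto {}^xm$, such that for all $x,y\in L$, $m,m'\in M$: ${}^{[x,y]}\alpha_M(m)={}^{\alpha_L(x)}({}^ym)-{}^{\alpha_L(y)}({}^xm)$; ${}^{\alpha_L(x)}[m,m']=[{}^xm,\alpha_M(m')]+[\alpha_M(m),{}^xm']$;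 $\alpha_M({}^xm)={}^{\alpha_L(x)}\alpha_M(m)$. Hom-actions of $(M,\alpha_M)$ and $(N,\alpha_N)$ on each other are compatible if ${}^{({}^mn)}m'=[m',{}^nm]$ and ${}^{({}^nm)}n'=[n',{}^mn]$. Non-abelian tensor product: for $(M,\alpha_M)$, $(N,\alpha_N)$ acting compatibly on each other, $M\star N=(M\otimes N)/D(M,N)$, where $D(M,N)$ is the subspace generated by all elements (a) $[m,m']\otimes\alpha_N(n)-\alpha_M(m)\otimes{}^{m'}n+\alpha_M(m')\otimes{}^mn$; (b) $\alpha_M(m)\otimes[n,n']-{}^{n'}m\otimes\alpha_N(n)+{}^nm\otimes\alpha_N(n')$; (c) ${}^nm\otimes{}^mn$; (d) ${}^nm\otimes{}^{m'}n'+{}^{n'}m'\otimes{}^mn$; (e) $[{}^nm,{}^{n'}m']\otimes\alpha_N({}^{m''}n'')+[{}^{n'}m',{}^{n''}m'']\otimes\alpha_N({}^mn)+[{}^{n''}m'',{}^nm]\otimes\alpha_N({}^{m'}n')$. The class of $m\otimes n$ is $m\star n$; the product is $[m\star n,m'\star n']=-{}^nm\star{}^{m'}n'$ and the endomorphism is $\alpha_{M\star N}(m\star n)=\alpha_M(m)\star\alpha_N(n)$. For an ideal $M$ of $L$, $M$ and $L$ act compatibly on each other via the product of $L$ (${}^ml=[m,l]$, ${}^lm=[l,m]$), and $\psi_M:M\star L\to M$ is $\psi_M(m\star l)=-{}^lm=[m,l]$. Homology: $H_n^\alpha(L)$ denotes the $n$-th homology of the complex $C_n^\alpha(L)=\wedge^nL$,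 $n\ge 0$ (trivial coefficients $\mathbb{K}$), with boundary $$d_n(x_1\wedge\cdots\wedge x_n)=\sum_{1\le i<j\le n}(-1)^{i+j}[x_i,x_j]\wedge\alpha_L(x_1)\wedge\cdots\wedge\widehat{\alpha_L(x_i)}\wedge\cdots\wedge\widehat{\alpha_L(x_j)}\wedge\cdots\wedge\alpha_L(x_n).$$ *)

(* Defs.v *)
From HB Require Import structures.
From mathcomp Require Import all_boot all_order all_algebra.
From mathcomp Require Import generic_quotient ring_quotient zify.
From mathcomp Require Import boolp classical_sets.
From mathcomp.multinomials Require Import freeg.

Set Implicit Arguments.
Unset Strict Implicit.
Unset Printing Implicit Defensive.

Import GRing.Theory.
Local Open Scope ring_scope.
Local Open Scope quotient_scope.

Section Span.
Variables (K : fieldType) (V : lmodType K).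

(* The intersection of all subspaces containing S. *)
Definition lspan (S : set V) : {pred V} :=
  fun v => `[< forall W : submodClosed V, (forall s, S s -> s \in W) -> v \in W >].

Lemma lspan_submod S : submod_closed (lspan S).
Proof.
split=> [|a u v /asboolP Su /asboolP Sv]; apply/asboolP => W SW.
  exact: rpred0.
by apply: rpredD; [apply: rpredZ; apply: Su|apply: Sv].
Qed.

HB.instance Definition _ S := GRing.isSubmodClosed.Build K V (lspan S)
  (lspan_submod S).

Lemma mem_lspan (S : set V) s : S s -> s \in lspan S.
Proof. by move=> Ss; apply/asboolP => W; apply. Qed.

Lemma lspan_sub (S : set V) (W : submodClosed V) v :
  (forall s, S s -> s \in W) -> v \in lspan S -> v \in W.
Proof. by move=> SW /asboolP; apply. Qed.

End Span.

Section Quotient.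
Variables (K : fieldType) (V : lmodType K) (W : submodClosed V).

Definition zmod_pred : {pred V} := fun v => v \in W.

Fact zmod_pred_closed : zmod_closed zmod_pred.
Proof. exact: GRing.submod_closedB (submodClosedP W). Qed.

HB.instance Definition _ := GRing.isZmodClosed.Build V zmod_pred
  zmod_pred_closed.

Definition lquot : Type := Quotient.quot zmod_pred.

HB.instance Definition _ := GRing.Zmodule.on lquot.

Definition lpi (v : V) : lquot := \pi_(Quotient.quot zmod_pred) v.
Definition lrepr (x : lquot) : V := repr (x : Quotient.quot zmod_pred).

Lemma lreprK x : lpi (lrepr x) = x. Proof. exact: reprK. Qed.

Lemma lpi_eq u v : (lpi u = lpi v) <-> (u - v \in W).
Proof.
rewrite -[_ \in W]/(u - v \in zmod_pred) Quotient.idealrBE.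
by split=> /eqP.
Qed.

Fact lpiD : {morph lpi : u v / u + v}.
Proof. by move=> u v; exact: (@raddfD _ _ \pi_(Quotient.quot zmod_pred)). Qed.

Definition lquot_scale (a : K) (x : lquot) : lquot := lpi (a *: lrepr x).

Fact lpi_scale a v : lquot_scale a (lpi v) = lpi (a *: v).
Proof.
by apply/lpi_eq; rewrite -scalerBr; apply/rpredZ/lpi_eq; rewrite lreprK.
Qed.

Fact lquot_scaleA a b x :
  lquot_scale a (lquot_scale b x) = lquot_scale (a * b) x.
Proof. by rewrite -[x]lreprK !lpi_scale scalerA. Qed.

Fact lquot_scale1 : left_id 1 lquot_scale.
Proof. by move=> x; rewrite -[x]lreprK lpi_scale scale1r. Qed.

Fact lquot_scaleDr : right_distributive lquot_scale +%R.
Proof.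
by move=> a x y; rewrite -[x]lreprK -[y]lreprK -lpiD !lpi_scale -lpiD scalerDr.
Qed.

Fact lquot_scaleDl x : {morph lquot_scale^~ x : a b / a + b}.
Proof. by move=> a b; rewrite -[x]lreprK !lpi_scale -lpiD scalerDl. Qed.

HB.instance Definition _ := GRing.Zmodule_isLmodule.Build K lquot
  lquot_scaleA lquot_scale1 lquot_scaleDr lquot_scaleDl.

Fact lpi_linear : linear lpi.
Proof. by move=> a u v; rewrite lpiD -lpi_scale. Qed.

HB.instance Definition _ := GRing.isLinear.Build K V lquot _ lpi lpi_linear.

Section Lift.
Variables (U : lmodType K) (f : {linear V -> U}).
Hypothesis f0 : forall v, v \in W -> f v = 0.

Definition lquot_lift of (forall v, v \in W -> f v = 0) :=
  fun x : lquot => f (lrepr x).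

Lemma lquot_liftE v : lquot_lift f0 (lpi v) = f v.
Proof.
apply/eqP; rewrite -subr_eq0 -raddfB; apply/eqP/f0/lpi_eq.
by rewrite lreprK.
Qed.

Fact lquot_lift_linear : linear (lquot_lift f0).
Proof.
by move=> a x y; rewrite -[x]lreprK -[y]lreprK -linearP !lquot_liftE linearP.
Qed.

HB.instance Definition _ :=
  GRing.isLinear.Build K lquot U _ (lquot_lift f0) lquot_lift_linear.
End Lift.

End Quotient.

Section SubspaceType.
Variables (K : fieldType) (V : lmodType K) (W : submodClosed V).

Definition subsp : Type := {v : V | v \in W}.

HB.instance Definition _ := SubChoice.on subsp.
HB.instance Definition _ := [SubChoice_isSubLmodule of subsp by <:].

End SubspaceType.

Section Kernel.
Variables (K : fieldType) (U V : lmodType K) (f : {linear U -> V}).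

Definition lin_ker : {pred U} := fun u => f u == 0.

Fact lin_ker_submod : submod_closed lin_ker.
Proof.
split=> [|a u v /eqP fu /eqP fv]; apply/eqP; first exact: linear0.
by rewrite linearP fu fv scaler0 addr0.
Qed.

HB.instance Definition _ := GRing.isSubmodClosed.Build K U lin_ker lin_ker_submod.

End Kernel.

Section FreeModule.
Variables (K : fieldType) (T : choiceType) (V : lmodType K) (f : T -> V).

Definition gen (t : T) : {freeg T / K} := << t >>.

Definition free_lift : {freeg T / K} -> V := fglift f.

Lemma free_liftE t : free_lift (gen t) = f t.
Proof. by rewrite /free_lift liftU scale1r. Qed.

Fact free_lift_zmod : zmod_morphism free_lift.
Proof. exact: lift_is_additive. Qed.

HB.instance Definition _ :=
  GRing.isZmodMorphism.Build {freeg T / K} V free_lift free_lift_zmod.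

Fact free_lift_scalable : scalable free_lift.
Proof.
move=> a D; rewrite -[in RHS](freeg_sumE D).
rewrite [a *: D]/(fgscale a D) /fgscale [LHS]raddf_sum.
rewrite [in RHS]raddf_sum scaler_sumr.
by apply: eq_bigr => t _ /=; rewrite /free_lift !liftU scalerA.
Qed.

HB.instance Definition _ :=
  GRing.isScalable.Build K {freeg T / K} V _ free_lift free_lift_scalable.

End FreeModule.

Section Tensor.
Variables (K : fieldType) (U V : lmodType K).

Inductive tensor_rel : {freeg (U * V) / K} -> Prop :=
  | Tensor_linearl a u u' v : tensor_rel
      (gen K (a *: u + u', v) - a *: gen K (u, v) - gen K (u', v))
  | Tensor_linearr a u v v' : tensor_rel
      (gen K (u, a *: v + v') - a *: gen K (u, v) - gen K (u, v')).

Definition tensor : lmodType K := lquot (lspan tensor_rel).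

Definition tens (u : U) (v : V) : tensor := lpi (lspan tensor_rel) (gen K (u, v)).

Section Lift.
Variables (W : lmodType K) (f : U -> V -> W).
Hypotheses (f_linearl : forall v, linear (f^~ v)) (f_linearr : forall u, linear (f u)).

Fact tensor_lift_subproof r : r \in lspan tensor_rel ->
  free_lift (fun p => f p.1 p.2) r = 0.
Proof.
move=> rP; apply/eqP; apply: (lspan_sub (W := lin_ker _) _ rP) => s [] a u v w;
  by rewrite unfold_in /lin_ker !linearB linearZ /= !free_liftE /=
     (f_linearl, f_linearr) addrAC addrK subrr.
Qed.

Definition tensor_lift : {linear tensor -> W} := lquot_lift tensor_lift_subproof.

Lemma tensor_liftE u v : tensor_lift (tens u v) = f u v.
Proof. exact: etrans (lquot_liftE _ _) (free_liftE _ _). Qed.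

End Lift.
End Tensor.

Arguments tens {K U V}.

Section ExteriorPower.
Variables (K : fieldType) (V : lmodType K) (n : nat).

Definition upd (x : {ffun 'I_n -> V}) (i : 'I_n) (u : V) : {ffun 'I_n -> V} :=
  [ffun k => if k == i then u else x k].

Inductive ext_rel : {freeg {ffun 'I_n -> V} / K} -> Prop :=
  | Ext_linear x i a u v : ext_rel
      (gen K (upd x i (a *: u + v)) - a *: gen K (upd x i u) - gen K (upd x i v))
  | Ext_alternate (x : {ffun 'I_n -> V}) i j : i != j -> x i = x j -> ext_rel (gen K x).

Definition ext : lmodType K := lquot (lspan ext_rel).

Definition wedge (x : {ffun 'I_n -> V}) : ext := lpi (lspan ext_rel) (gen K x).

Lemma wedge_linear x i a u v :
  wedge (upd x i (a *: u + v)) = a *: wedge (upd x i u) + wedge (upd x i v).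
Proof.
apply/eqP; rewrite -subr_eq0 opprD addrA -linearZ -!linearB.
by apply/eqP; rewrite -(linear0 (lpi _)); apply/lpi_eq; rewrite subr0;
  apply/mem_lspan/Ext_linear.
Qed.

Lemma wedge_alternate (x : {ffun 'I_n -> V}) i j : i != j -> x i = x j -> wedge x = 0.
Proof.
move=> ij xij; rewrite -(linear0 (lpi _)); apply/lpi_eq; rewrite subr0.
exact/mem_lspan/(Ext_alternate ij).
Qed.

Lemma wedge0 (x : {ffun 'I_n -> V}) i : x i = 0 -> wedge x = 0.
Proof.
move=> xi0; have xE : upd x i 0 = x by apply/ffunP => k; rewrite ffunE; case: eqP => // ->.
by have := wedge_linear x i (-1) 0 0; rewrite scaler0 addr0 xE scaleN1r addNr.
Qed.

Section Lift.
Variables (W : lmodType K) (f : {ffun 'I_n -> V} -> W).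
Hypothesis f_linear : forall x i a u v,
  f (upd x i (a *: u + v)) = a *: f (upd x i u) + f (upd x i v).
Hypothesis f_alternate : forall (x : {ffun 'I_n -> V}) i j, i != j -> x i = x j -> f x = 0.

Fact ext_lift_subproof r : r \in lspan ext_rel -> free_lift f r = 0.
Proof.
move=> rP; apply/eqP; apply: (lspan_sub (W := lin_ker _) _ rP).
move=> s [x i a u v|x i j ij xij]; rewrite unfold_in /lin_ker.
  by rewrite !linearB linearZ /= !free_liftE f_linear addrAC addrK subrr.
by rewrite /= free_liftE (f_alternate ij).
Qed.

Definition ext_lift : {linear ext -> W} := lquot_lift ext_lift_subproof.

Lemma ext_liftE x : ext_lift (wedge x) = f x.
Proof. exact: etrans (lquot_liftE _ _) (free_liftE _ _). Qed.

End Lift.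
End ExteriorPower.

(* hlbrxx is equivalent to the antisymmetry [x, y] = - [y, x] (hlbrC below)
   unless K has characteristic 2, where it has to be required: otherwise the
   boundary map x /\ y |-> - [x, y] is not defined on the exterior square. *)
HB.mixin Record isHomLie (K : fieldType) L of GRing.Lmodule K L := {
  hlbr : L -> L -> L;
  hlalpha : L -> L;
  hlbr_linearl : forall z, linear (hlbr^~ z);
  hlbr_linearr : forall z, linear (hlbr z);
  hlalpha_linear : linear hlalpha;
  hlbrxx : forall x, hlbr x x = 0;
  hl_jacobi : forall x y z,
    hlbr (hlalpha x) (hlbr y z) + hlbr (hlalpha z) (hlbr x y)
      + hlbr (hlalpha y) (hlbr z x) = 0;
  hlalphaM : forall x y, hlalpha (hlbr x y) = hlbr (hlalpha x) (hlalpha y)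
}.

#[short(type="homLieType")]
HB.structure Definition HomLie (K : fieldType) :=
  {L of GRing.Lmodule K L & isHomLie K L}.

Notation "{[ x , y ]}" := (hlbr x y) (at level 0, format "{[ x ,  y ]}").

HB.instance Definition _ (K : fieldType) (L : homLieType K) :=
  GRing.isLinear.Build K L L _ (@hlalpha K L) hlalpha_linear.
HB.instance Definition _ (K : fieldType) (L : homLieType K) (x : L) :=
  GRing.isLinear.Build K L L _ (hlbr x) (hlbr_linearr x).

Section HomLieTheory.
Variables (K : fieldType) (L : homLieType K).
Implicit Types x y z : L.

Lemma hlbrDl x y z : {[x + y, z]} = {[x, z]} + {[y, z]}.
Proof. by have := hlbr_linearl z 1 x y; rewrite /= !scale1r. Qed.

Lemma hlbrBl x y z : {[x - y, z]} = {[x, z]} - {[y, z]}.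
Proof.
by have := hlbr_linearl z (-1) y x; rewrite /= !scaleN1r [x - y]addrC [RHS]addrC.
Qed.

Lemma hlbrC x y : {[x, y]} = - {[y, x]}.
Proof.
apply/eqP; rewrite -addr_eq0; apply/eqP.
have := hlbrxx (x + y).
by rewrite hlbrDl !linearD /= !hlbrxx add0r addr0.
Qed.

Lemma hlbrNl x y : {[- x, y]} = - {[x, y]}.
Proof. by rewrite -[- x]sub0r hlbrBl [{[0, y]}]hlbrC linear0 oppr0 sub0r. Qed.

Lemma hlbrNr x y : {[x, - y]} = - {[x, y]}.
Proof. exact: linearN. Qed.

Definition perfect : Prop :=
  forall x : L, x \in lspan [set y | exists a b : L, y = {[a, b]}]%classic.

End HomLieTheory.

Arguments perfect {K} L.

HB.mixin Record isHomIdeal (K : fieldType) (L : homLieType K) (S : L -> bool) := {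
  ideal_alpha : forall x, S x -> S (hlalpha x);
  ideal_br : forall x y, S x -> S {[x, y]}
}.

#[short(type="homIdeal")]
HB.structure Definition HomIdeal (K : fieldType) (L : homLieType K) :=
  {S of @GRing.SubmodClosed K L S & isHomIdeal K L S}.

Section Ideals.
Variables (K : fieldType) (L : homLieType K) (M : homIdeal L).

Fact ideal_brr x y : y \in M -> {[x, y]} \in M.
Proof. by move=> yM; rewrite hlbrC -scaleN1r; apply/rpredZ/ideal_br. Qed.

Definition ideal_alg : Type := subsp M.
HB.instance Definition _ := GRing.Lmodule.on ideal_alg.

Definition ideal_val (x : ideal_alg) : L := val x.

Implicit Types x y z : ideal_alg.

Definition ideal_mk (x : L) (xM : x \in M) : ideal_alg := Sub x xM.

Definition ideal_hlbr x y : ideal_alg := ideal_mk (ideal_br _ (ideal_val y) (valP x)).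
Definition ideal_hlalpha x : ideal_alg := ideal_mk (ideal_alpha _ (valP x)).

Fact ideal_val_linear : linear ideal_val.
Proof. by []. Qed.

HB.instance Definition _ :=
  GRing.isLinear.Build K ideal_alg L _ ideal_val ideal_val_linear.

Fact ideal_val_inj : injective ideal_val. Proof. exact: val_inj. Qed.

Fact ideal_hlbr_linearl z : linear (ideal_hlbr^~ z).
Proof.
move=> a x y; apply: ideal_val_inj; rewrite linearP.
exact: hlbr_linearl (ideal_val z) a (ideal_val x) (ideal_val y).
Qed.

Fact ideal_hlbr_linearr z : linear (ideal_hlbr z).
Proof.
move=> a x y; apply: ideal_val_inj; rewrite linearP.
exact: hlbr_linearr (ideal_val z) a (ideal_val x) (ideal_val y).
Qed.

Fact ideal_hlalpha_linear : linear ideal_hlalpha.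
Proof.
move=> a x y; apply: ideal_val_inj; rewrite linearP.
exact: hlalpha_linear a (ideal_val x) (ideal_val y).
Qed.

Fact ideal_hlbrxx x : ideal_hlbr x x = 0.
Proof. by apply: ideal_val_inj; apply: hlbrxx. Qed.

Fact ideal_jacobi x y z :
  ideal_hlbr (ideal_hlalpha x) (ideal_hlbr y z)
    + ideal_hlbr (ideal_hlalpha z) (ideal_hlbr x y)
    + ideal_hlbr (ideal_hlalpha y) (ideal_hlbr z x) = 0.
Proof.
by apply: ideal_val_inj; apply: hl_jacobi.
Qed.

Fact ideal_hlalphaM x y :
  ideal_hlalpha (ideal_hlbr x y) = ideal_hlbr (ideal_hlalpha x) (ideal_hlalpha y).
Proof. by apply: ideal_val_inj; apply: hlalphaM. Qed.

HB.instance Definition _ := isHomLie.Build K ideal_alg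
  ideal_hlbr_linearl ideal_hlbr_linearr ideal_hlalpha_linear ideal_hlbrxx
  ideal_jacobi ideal_hlalphaM.

Definition quot_alg : Type := lquot M.
HB.instance Definition _ := GRing.Lmodule.on quot_alg.

Definition quot_pi (x : L) : quot_alg := lpi M x.
HB.instance Definition _ :=
  GRing.isLinear.Build K L quot_alg _ quot_pi (@lpi_linear _ _ M).

Implicit Types u v w : quot_alg.

Definition quot_hlbr u v : quot_alg := quot_pi {[lrepr u, lrepr v]}.
Definition quot_hlalpha u : quot_alg := quot_pi (hlalpha (lrepr u)).

Fact quot_reprE u : exists x : L, u = quot_pi x.
Proof. by exists (lrepr u); rewrite /quot_pi lreprK. Qed.

Fact quot_lreprB (x : L) : lrepr (quot_pi x) - x \in M.
Proof. by apply/lpi_eq; rewrite lreprK. Qed.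

Lemma quot_hlbrE (x y : L) : quot_hlbr (quot_pi x) (quot_pi y) = quot_pi {[x, y]}.
Proof.
apply/lpi_eq; set x' := lrepr _; set y' := lrepr _.
have -> : {[x', y']} - {[x, y]} = {[x' - x, y']} + {[x, y' - y]}.
  by rewrite linearB /= hlbrBl addrA addrNK.
by apply: rpredD; [apply: ideal_br|apply: ideal_brr]; apply: quot_lreprB.
Qed.

Lemma quot_hlalphaE (x : L) : quot_hlalpha (quot_pi x) = quot_pi (hlalpha x).
Proof. by apply/lpi_eq; rewrite -linearB; apply/ideal_alpha/quot_lreprB. Qed.

Fact quot_hlbr_linearl w : linear (quot_hlbr^~ w).
Proof.
have [z ->] := quot_reprE w => a u v.
have [x ->] := quot_reprE u; have [y ->] := quot_reprE v.
by rewrite -linearP !quot_hlbrE hlbr_linearl linearP.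
Qed.

Fact quot_hlbr_linearr w : linear (quot_hlbr w).
Proof.
have [z ->] := quot_reprE w => a u v.
have [x ->] := quot_reprE u; have [y ->] := quot_reprE v.
by rewrite -linearP !quot_hlbrE hlbr_linearr linearP.
Qed.

Fact quot_hlalpha_linear : linear quot_hlalpha.
Proof.
move=> a u v; have [x ->] := quot_reprE u; have [y ->] := quot_reprE v.
by rewrite -linearP !quot_hlalphaE hlalpha_linear linearP.
Qed.

Fact quot_hlbrxx u : quot_hlbr u u = 0.
Proof. by have [x ->] := quot_reprE u; rewrite quot_hlbrE hlbrxx linear0. Qed.

Fact quot_jacobi u v w :
  quot_hlbr (quot_hlalpha u) (quot_hlbr v w)
    + quot_hlbr (quot_hlalpha w) (quot_hlbr u v)
    + quot_hlbr (quot_hlalpha v) (quot_hlbr w u) = 0.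
Proof.
have [x ->] := quot_reprE u; have [y ->] := quot_reprE v.
have [z ->] := quot_reprE w.
by rewrite !quot_hlalphaE !quot_hlbrE -!linearD hl_jacobi linear0.
Qed.

Fact quot_hlalphaM u v :
  quot_hlalpha (quot_hlbr u v) = quot_hlbr (quot_hlalpha u) (quot_hlalpha v).
Proof.
have [x ->] := quot_reprE u; have [y ->] := quot_reprE v.
by rewrite quot_hlbrE !quot_hlalphaE quot_hlbrE hlalphaM.
Qed.

HB.instance Definition _ := isHomLie.Build K quot_alg
  quot_hlbr_linearl quot_hlbr_linearr quot_hlalpha_linear quot_hlbrxx
  quot_jacobi quot_hlalphaM.

End Ideals.

Record homAction (K : fieldType) (L M : homLieType K) := HomAction {
  act :> L -> M -> M;
  act_linearl : forall m, linear (act^~ m);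
  act_linearr : forall x, linear (act x);
  act_hlbrl : forall x y m,
    act {[x, y]} (hlalpha m)
      = act (hlalpha x) (act y m) - act (hlalpha y) (act x m);
  act_hlbrr : forall x m m',
    act (hlalpha x) {[m, m']}
      = {[act x m, hlalpha m']} + {[hlalpha m, act x m']};
  act_hlalpha : forall x m, hlalpha (act x m) = act (hlalpha x) (hlalpha m)
}.

Section Star.
Variables (K : fieldType) (M N : homLieType K).
Variables (aMN : homAction M N) (aNM : homAction N M).

Definition compatible :=
  (forall m n m', aNM (aMN m n) m' = {[m', aNM n m]}) /\
  (forall m n n', aMN (aNM n m) n' = {[n', aMN m n]}).

Inductive star_rel : tensor M N -> Prop :=
  | Star_a m m' n : star_rel
      (tens {[m, m']} (hlalpha n) - tens (hlalpha m) (aMN m' n)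
       + tens (hlalpha m') (aMN m n))
  | Star_b m n n' : star_rel
      (tens (hlalpha m) {[n, n']} - tens (aNM n' m) (hlalpha n)
       + tens (aNM n m) (hlalpha n'))
  | Star_c m n : star_rel (tens (aNM n m) (aMN m n))
  | Star_d m m' n n' : star_rel
      (tens (aNM n m) (aMN m' n') + tens (aNM n' m') (aMN m n))
  | Star_e m m' m'' n n' n'' : star_rel
      (tens {[aNM n m, aNM n' m']} (hlalpha (aMN m'' n''))
       + tens {[aNM n' m', aNM n'' m'']} (hlalpha (aMN m n))
       + tens {[aNM n'' m'', aNM n m]} (hlalpha (aMN m' n'))).

(* The underlying vector space of the non-abelian tensor product; it is only
   meaningful for compatible actions. *)
Definition star : lmodType K := lquot (lspan star_rel).

Definition star_mk (m : M) (n : N) : star := lpi (lspan star_rel) (tens m n).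

End Star.

Section IdealActions.
Variables (K : fieldType) (L : homLieType K) (M : homIdeal L).

Local Notation MM := (ideal_alg M).

Definition ideal_actl_fun (m : MM) (l : L) : L := {[ideal_val m, l]}.
Definition ideal_actr_fun (l : L) (m : MM) : MM :=
  ideal_mk (ideal_brr l (valP m)).

Fact ideal_actl_linearl l : linear (ideal_actl_fun^~ l).
Proof. exact: (fun a x y => hlbr_linearl l a (ideal_val x) (ideal_val y)). Qed.

Fact ideal_actl_linearr m : linear (ideal_actl_fun m).
Proof. exact: hlbr_linearr. Qed.

Fact hl_jacobi_act (x y z : L) :
  {[{[x, y]}, hlalpha z]} = {[hlalpha x, {[y, z]}]} - {[hlalpha y, {[x, z]}]}.
Proof.
have := hl_jacobi x y z.
rewrite [{[hlalpha z, _]}]hlbrC [{[z, x]}]hlbrC linearN /= => e.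
apply/eqP; rewrite eq_sym -subr_eq0 addrAC; exact/eqP.
Qed.

Fact hl_jacobi_der (x y z : L) :
  {[hlalpha x, {[y, z]}]} = {[{[x, y]}, hlalpha z]} + {[hlalpha y, {[x, z]}]}.
Proof. by rewrite hl_jacobi_act addrNK. Qed.

Definition ideal_actl : homAction MM L.
Proof.
exists ideal_actl_fun; [exact: ideal_actl_linearl|exact: ideal_actl_linearr|..].
- by move=> x y m; apply: hl_jacobi_act.
- by move=> x m m'; apply: hl_jacobi_der.
- by move=> x m; apply: hlalphaM.
Defined.

Definition ideal_actr : homAction L MM.
Proof.
exists ideal_actr_fun.
- move=> m a x y; apply: ideal_val_inj; rewrite linearP; exact: hlbr_linearl.
- move=> x a m m'; apply: ideal_val_inj; rewrite linearP; exact: hlbr_linearr.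
- move=> x y m; apply: ideal_val_inj; rewrite linearB; exact: hl_jacobi_act.
- move=> x m m'; apply: ideal_val_inj; rewrite linearD; exact: hl_jacobi_der.
- move=> x m; apply: ideal_val_inj; exact: hlalphaM.
Defined.

Fact hlbr_flip (x y z : L) : {[{[x, y]}, z]} = {[z, {[y, x]}]}.
Proof. by rewrite hlbrC [{[x, y]}]hlbrC linearN opprK. Qed.

Lemma ideal_act_compatible : compatible ideal_actl ideal_actr.
Proof.
by split=> [m l m'|m l l']; [apply: ideal_val_inj|]; apply: hlbr_flip.
Qed.

Definition istar : lmodType K := star ideal_actl ideal_actr.

Definition psi_fun (m : MM) (l : L) : MM := ideal_mk (ideal_br _ l (valP m)).

Fact psi_fun_linearl l : linear (psi_fun^~ l).
Proof.
by move=> a x y; apply: ideal_val_inj; rewrite linearP; apply: hlbr_linearl.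
Qed.

Fact psi_fun_linearr m : linear (psi_fun m).
Proof.
by move=> a x y; apply: ideal_val_inj; rewrite linearP; apply: hlbr_linearr.
Qed.

Definition psi_tensor : {linear tensor MM L -> MM} :=
  tensor_lift psi_fun_linearl psi_fun_linearr.

Fact psi_tensorE m l : ideal_val (psi_tensor (tens m l)) = {[ideal_val m, l]}.
Proof. by rewrite [psi_tensor _]tensor_liftE. Qed.

Fact psi_rel_a (m m' l : L) :
  {[{[m, m']}, hlalpha l]} - {[hlalpha m, {[m', l]}]}
    + {[hlalpha m', {[m, l]}]} = 0.
Proof. by rewrite hl_jacobi_act addrAC addrNK subrr. Qed.

Fact psi_rel_b (m l l' : L) :
  {[hlalpha m, {[l, l']}]} - {[{[l', m]}, hlalpha l]}
    + {[{[l, m]}, hlalpha l']} = 0.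
Proof.
rewrite hl_jacobi_der [{[l', m]}]hlbrC [{[l, m]}]hlbrC !hlbrNl opprK.
by rewrite [{[hlalpha l, _]}]hlbrC addrNK subrr.
Qed.

Fact psi_rel_c (m l : L) : {[{[l, m]}, {[m, l]}]} = 0.
Proof. by rewrite [{[m, l]}]hlbrC linearN /= hlbrxx oppr0. Qed.

Fact psi_rel_d (m m' l l' : L) :
  {[{[l, m]}, {[m', l']}]} + {[{[l', m']}, {[m, l]}]} = 0.
Proof.
rewrite [{[m', l']}]hlbrC [{[m, l]}]hlbrC !linearN /=.
by rewrite [{[{[l', m']}, _]}]hlbrC opprK addNr.
Qed.

Fact psi_rel_e (m m' m'' l l' l'' : L) :
  {[{[{[l, m]}, {[l', m']}]}, hlalpha {[m'', l'']}]}
    + {[{[{[l', m']}, {[l'', m'']}]}, hlalpha {[m, l]}]}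
    + {[{[{[l'', m'']}, {[l, m]}]}, hlalpha {[m', l']}]} = 0.
Proof.
rewrite [{[m'', l'']}]hlbrC [{[m', l']}]hlbrC [{[m, l]}]hlbrC.
move: {[l, m]} {[l', m']} {[l'', m'']} => x y z.
rewrite !linearN /=.
rewrite [{[{[x, y]}, _]}]hlbrC [{[{[y, z]}, _]}]hlbrC [{[{[z, x]}, _]}]hlbrC.
by rewrite !opprK -(hl_jacobi x y z) [{[hlalpha z, _]} + _]addrC.
Qed.

Fact psi_subproof r :
  r \in lspan (star_rel ideal_actl ideal_actr) -> psi_tensor r = 0.
Proof.
have phiD x y : ideal_val (psi_tensor (x + y))
    = ideal_val (psi_tensor x) + ideal_val (psi_tensor y) by rewrite !linearD.
have phiN x : ideal_val (psi_tensor (- x)) = - ideal_val (psi_tensor x).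
  by rewrite !linearN.
move=> rP; apply/eqP; apply: (lspan_sub (W := lin_ker psi_tensor) _ rP) => s sR.
apply/eqP; apply: ideal_val_inj; rewrite linear0.
case: s / sR => [m m' l|m l l'|m l|m m' l l'|m m' m'' l l' l''];
  rewrite ?phiD ?phiN !psi_tensorE.
- exact: psi_rel_a.
- exact: psi_rel_b.
- exact: psi_rel_c.
- exact: psi_rel_d.
- exact: psi_rel_e.
Qed.

Definition psi : {linear istar -> MM} := lquot_lift psi_subproof.

Lemma psiE m l :
  ideal_val (psi (star_mk ideal_actl ideal_actr m l)) = {[ideal_val m, l]}.
Proof. by rewrite [psi _]lquot_liftE psi_tensorE. Qed.

(* M / [L, M] *)
Definition ideal_coinv : lmodType K :=
  lquot (lspan [set u | exists (l : L) (m : MM), u = ideal_actr l m]%classic).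

End IdealActions.

Section Homology.
Variables (K : fieldType) (L : homLieType K).

(* A multilinear map vanishing on families with two equal neighbours is
   alternating. *)
Fact adjacent_alternate (V W : lmodType K) m (f : {ffun 'I_m -> V} -> W) :
    (forall x i a u v, f (upd x i (a *: u + v)) = a *: f (upd x i u) + f (upd x i v)) ->
    (forall (x : {ffun 'I_m -> V}) (p q : 'I_m),
       q = p.+1 :> nat -> x p = x q -> f x = 0) ->
  forall (x : {ffun 'I_m -> V}) p q, p != q -> x p = x q -> f x = 0.
Proof.
move=> f_lin f_adj.
have fD x i u v : f (upd x i (u + v)) = f (upd x i u) + f (upd x i v).
  by rewrite -[u in LHS]scale1r f_lin scale1r.
have H d : forall (x : {ffun 'I_m -> V}) (p q : 'I_m),
    q = (p + d.+1)%N :> nat -> x p = x q -> f x = 0.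
  elim: d => [|d IHd] x p q qE xpq.
    by apply: (f_adj x p q) => //; rewrite qE addn1.
  have r_lt : (p + d.+1 < m)%N by have := ltn_ord q; lia.
  pose r := Ordinal r_lt.
  have rq : (r == q) = false by rewrite -val_eqE /= qE; lia.
  have pq : (p == q) = false by rewrite -val_eqE /= qE; lia.
  have pr : (p == r) = false by rewrite -val_eqE /=; lia.
  pose y u v := upd (upd x r u) q v.
  have yC u v : y u v = upd (upd x q v) r u.
    apply/ffunP => k; rewrite !ffunE; case: eqP => // ->.
    by rewrite eq_sym rq.
  have yDr u v w : f (y u (v + w)) = f (y u v) + f (y u w) by apply: fD.
  have yDl u v w : f (y (u + v) w) = f (y u w) + f (y v w) by rewrite !yC fD.
  have y0 u : f (y u u) = 0.
    by apply: (f_adj _ r q); [rewrite /= qE; lia|rewrite !ffunE eqxx rq eqxx].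
  have xE : x = y (x r) (x q).
    by apply/ffunP => k; rewrite !ffunE; do 2![case: eqP => [->|_] //].
  have : f (y (x r + x q) (x r + x q)) = 0 by exact: y0.
  rewrite yDl !yDr !y0 add0r addr0 -xE => /eqP.
  rewrite addr_eq0 => /eqP->; rewrite (IHd _ p r) ?oppr0 //.
  by rewrite !ffunE pq pr eqxx rq.
move=> x p q pq xpq; have [lt_pq|lt_qp|e] := ltngtP p q.
- by apply: (H (q - p).-1 x p q) => //; lia.
- by apply: (H (p - q).-1 x q p) => //; lia.
- by rewrite (val_inj e) eqxx in pq.
Qed.

Section Boundary.
Variable n : nat.

(* For i < j, k |-> bump j (bump i k) enumerates increasingly the indices
   distinct from i and j, so that hl_face i j x is the family
   [x_i, x_j], alpha x_0, .., (i and j omitted), .., alpha x_n. *)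
Definition hl_face (i j : 'I_n.+1) (x : {ffun 'I_n.+1 -> L}) : {ffun 'I_n -> L} :=
  [ffun k : 'I_n => if k == 0 :> nat then {[x i, x j]}
                    else hlalpha (x (inord (bump j (bump i k.-1))))].

(* Indices start from 0, which does not change the parity of i + j. *)
Definition hl_bound_fun (x : {ffun 'I_n.+1 -> L}) : ext L n :=
  \sum_(i < n.+1) \sum_(j < n.+1 | (i < j)%N) (-1) ^+ (i + j) *: wedge (hl_face i j x).

Fact hl_face_index (i j r : 'I_n.+1) : (i < j)%N -> i != r -> j != r ->
  exists2 k : 'I_n, k != 0 :> nat & bump j (bump i k.-1) = r.
Proof.
rewrite -!val_eqE /= => ij ir jr; have rn := ltn_ord r; have jn := ltn_ord j.
have kn : ((unbump i (unbump j r)).+1 < n)%N by rewrite /unbump; lia.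
by exists (Ordinal kn) => //=; rewrite /unbump /bump; lia.
Qed.

Fact hl_face_upd (i j p : 'I_n.+1) x u v a : (i < j)%N ->
  wedge (hl_face i j (upd x p (a *: u + v)))
    = a *: wedge (hl_face i j (upd x p u)) + wedge (hl_face i j (upd x p v)).
Proof.
move=> ij; have n_gt0 : (0 < n)%N by have := ltn_ord j; lia.
pose k0 := Ordinal n_gt0.
have bumpP k : (k < n)%N -> k != 0 ->
  [/\ (bump j (bump i k.-1) < n.+1)%N, bump j (bump i k.-1) != i &
      bump j (bump i k.-1) != j].
  by rewrite /bump => kn k0'; split; lia.
have k0E (k : 'I_n) : (k == k0) = (k == 0 :> nat) by [].
have ijF : (i == j) = false by apply/eqP => e; rewrite e ltnn in ij.
have [pi|pi] := eqVneq p i.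
  have face w : hl_face i j (upd x p w) = upd (hl_face i j x) k0 {[w, x j]}.
    apply/ffunP => k; rewrite !ffunE k0E pi eqxx [j == i]eq_sym ijF.
    case: eqP => // /eqP k_neq0; have [lt1 ne1 _] := bumpP k (ltn_ord k) k_neq0.
    by rewrite -[inord _ == i]val_eqE /= inordK // (negPf ne1).
  by rewrite !face hlbr_linearl wedge_linear.
have [pj|pj] := eqVneq p j.
  have face w : hl_face i j (upd x p w) = upd (hl_face i j x) k0 {[x i, w]}.
    apply/ffunP => k; rewrite !ffunE k0E pj eqxx ijF.
    case: eqP => // /eqP k_neq0; have [lt1 _ ne2] := bumpP k (ltn_ord k) k_neq0.
    by rewrite -[inord _ == j]val_eqE /= inordK // (negPf ne2).
  by rewrite !face hlbr_linearr wedge_linear.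
have [k1 k1_neq0 k1E] : exists2 k : 'I_n, k != 0 :> nat & bump j (bump i k.-1) = p.
  by apply: hl_face_index; rewrite // eq_sym.
have face w : hl_face i j (upd x p w) = upd (hl_face i j x) k1 (hlalpha w).
  apply/ffunP => k; rewrite !ffunE ![_ == p]eq_sym (negPf pi) (negPf pj).
  have [->|kk1] := eqVneq k k1; first by rewrite (negPf k1_neq0) k1E inord_val eqxx.
  case: eqP => // /eqP k_neq0; have [lt1 _ _] := bumpP k (ltn_ord k) k_neq0.
  rewrite -[p == _]val_eqE /= inordK //; case: eqP => // pk.
  have e : k.-1 = k1.-1.
    by apply: (can_inj (bumpK i)); apply: (can_inj (bumpK j)); rewrite k1E.
  by case/eqP: kk1; apply: val_inj; rewrite /= -[LHS]prednK ?lt0n // e prednK ?lt0n.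
by rewrite !face hlalpha_linear wedge_linear.
Qed.

Fact hl_bound_linear x i a u v :
  hl_bound_fun (upd x i (a *: u + v))
    = a *: hl_bound_fun (upd x i u) + hl_bound_fun (upd x i v).
Proof.
rewrite /hl_bound_fun scaler_sumr -big_split; apply: eq_bigr => p _.
rewrite scaler_sumr -big_split; apply: eq_bigr => q pq.
by rewrite hl_face_upd // scalerDr !scalerA [a * _]mulrC.
Qed.

Fact hl_bound_adjacent (x : {ffun 'I_n.+1 -> L}) (p q : 'I_n.+1) :
  q = p.+1 :> nat -> x p = x q -> hl_bound_fun x = 0.
Proof.
move=> qp xpq; pose T (i j : 'I_n.+1) : ext L n :=
  if (i < j)%N then (-1) ^+ (i + j) *: wedge (hl_face i j x) else 0.
have pq : p != q by rewrite -val_eqE /= qp; lia.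
have TE : hl_bound_fun x = \sum_i \sum_j T i j.
  by apply: eq_bigr => i _; rewrite big_mkcond.
have x_inord (a b : nat) : a = b \/ a = p /\ b = q \/ a = q /\ b = p ->
    x (inord a) = x (inord b).
  by case=> [->|[[-> ->]|[-> ->]]]; rewrite ?inord_val.
have sgn a : (-1) ^+ (p + a) = - ((-1) ^+ (q + a)) :> K.
  by rewrite qp addSn exprS mulN1r opprK.
have T_diag : T p q = 0.
  have n_gt0 : (0 < n)%N by have := ltn_ord q; lia.
  rewrite /T (@wedge0 _ _ _ _ (Ordinal n_gt0)) ?scaler0 ?if_same //.
  by rewrite ffunE /= xpq hlbrxx.
have T_ge (i j : 'I_n.+1) : (j <= i)%N -> T i j = 0 by rewrite /T ltnNge => ->.
have T_out i j : i != p -> i != q -> j != p -> j != q -> T i j = 0.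
  rewrite /T => ip iq jp jq; case: ifP => // ij.
  have [kp kp0 kpE] := hl_face_index ij ip jp.
  have [kq kq0 kqE] := hl_face_index ij iq jq.
  rewrite (@wedge_alternate _ _ _ _ kp kq) ?scaler0 //.
    by apply: contra_neq pq => kpq; apply: val_inj; rewrite /= -kpE -kqE kpq.
  by rewrite !ffunE (negPf kp0) (negPf kq0) kpE kqE !inord_val xpq.
have T_row j : T p j + T q j = 0.
  have [->|jp] := eqVneq j p; first by rewrite !T_ge ?addr0 // qp.
  have [->|jq] := eqVneq j q; first by rewrite T_diag T_ge ?addr0.
  move: jp jq; rewrite -!val_eqE /= => jp jq.
  have [jp'|pj] := leqP j p; first by rewrite !T_ge ?addr0 // qp ltnW.
  rewrite /T pj (_ : q < j)%N; last by lia.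
  suff -> : hl_face p j x = hl_face q j x by rewrite sgn scaleNr addNr.
  apply/ffunP => k; rewrite !ffunE xpq; case: ifP => // _; congr (hlalpha _).
  by apply: x_inord; rewrite /bump; lia.
have T_col i : i != p -> i != q -> T i p + T i q = 0.
  rewrite -!val_eqE /= => ip iq.
  have [pi|ip'] := leqP p i; first by rewrite !T_ge ?addr0 //; lia.
  rewrite /T ip' (_ : i < q)%N; last by lia.
  suff -> : hl_face i p x = hl_face i q x.
    by rewrite ![(i + _)%N]addnC sgn scaleNr addNr.
  apply/ffunP => k; rewrite !ffunE xpq; case: ifP => // _; congr (hlalpha _).
  by apply: x_inord; rewrite /bump; lia.
rewrite TE [LHS](bigD1 p) //= [X in _ + X](bigD1 q) 1?eq_sym //= addrA -big_split /=.
rewrite [X in X + _]big1 ?add0r => [|j _]; last exact: T_row.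
apply: big1 => i /andP[ip iq]; rewrite (bigD1 p) //= (bigD1 q) 1?eq_sym //=.
by rewrite addrA T_col // add0r big1 // => j /andP[jp jq]; apply: T_out.
Qed.

Fact hl_bound_alternate (x : {ffun 'I_n.+1 -> L}) i j :
  i != j -> x i = x j -> hl_bound_fun x = 0.
Proof. exact: adjacent_alternate hl_bound_linear hl_bound_adjacent x i j. Qed.

Definition hl_bound : {linear ext L n.+1 -> ext L n} :=
  ext_lift hl_bound_linear hl_bound_alternate.

Lemma hl_boundE (x : {ffun 'I_n.+1 -> L}) : hl_bound (wedge x) = hl_bound_fun x.
Proof. exact: ext_liftE. Qed.

End Boundary.

Definition hl_cycle (n : nat) : {pred ext L n} :=
  match n with
  | 0 => fun=> true
  | m.+1 => lin_ker (hl_bound m)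
  end.
Arguments hl_cycle : clear implicits.

Fact hl_cycle_submod n : submod_closed (hl_cycle n).
Proof. by case: n => [|n] //; apply: lin_ker_submod. Qed.

HB.instance Definition _ n :=
  GRing.isSubmodClosed.Build K (ext L n) (hl_cycle n) (hl_cycle_submod n).

Definition hl_boundary (n : nat) : {pred subsp (hl_cycle n)} :=
  fun z => `[< exists w, hl_bound n w = val z >].
Arguments hl_boundary : clear implicits.

Fact hl_boundary_submod n : submod_closed (hl_boundary n).
Proof.
split=> [|a z z' /asboolP[w wz] /asboolP[w' wz']]; apply/asboolP.
  by exists 0; rewrite !linear0.
by exists (a *: w + w'); rewrite !linearP wz wz'.
Qed.

HB.instance Definition _ n :=
  GRing.isSubmodClosed.Build K (subsp (hl_cycle n)) (hl_boundary n)
    (hl_boundary_submod n).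

(* Z_n / (B_n :&: Z_n), where B_n is contained in Z_n as the boundary maps
   compose to 0. *)
Definition hl_homology (n : nat) : lmodType K := lquot (hl_boundary n).

End Homology.

Arguments hl_homology {K} L n.

Definition exact_at (K : fieldType) (U V W : lmodType K)
    (f : {linear U -> V}) (g : {linear V -> W}) : Prop :=
  forall v, g v = 0 <-> exists u, f u = v.

(* Main.v *)
Require Import Defs.
From HB Require Import structures.
From mathcomp Require Import all_boot all_order all_algebra.
From mathcomp Require Import boolp classical_sets.
From mathcomp.multinomials Require Import freeg.
Local Open Scope ring_scope.

Set Implicit Arguments.
Unset Strict Implicit.
Unset Printing Implicit Defensive.

Import GRing.Theory.

(** Write p : L -> L/M for the projection and let T : M (x) L -> /\^2 L send
    m (x) l to m /\ l.  The bracket factors through a linear map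
    br : /\^2 L -> L; up to the isomorphism /\^1 L = L it is - d_2, so that the
    2-cycles are the kernel of br, and br o d_3 = 0 is the Hom-Jacobi identity
    (ext_br_bound).  On M (x) L, br o T is the map m (x) l |-> [m, l], which
    induces psi on the star product and whose image is [L, M]
    (ext_br_tensor_wedge, ideal_coinv_eq0).  Two facts carry the proof.

    - The exterior square is right exact: the image of T is the kernel of
      /\^2 p (ext2_right_exact).
    - T sends the defining relations of the star product to boundaries
      (star_rel_bound): (a), (b) and (e) are instances of the formula for d_3,
      (c) and (d) hold already in /\^2 L.

    The three maps are then found by chasing chains.  The first sends the class
    of t, where psi kills t, to the homology class of the cycle T t.  The second
    is induced by /\^2 p, which commutes with the boundaries.  The third lifts a
    cycle of L/M to some y in /\^2 L; as p (br y) = 0, br y belongs to M, and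
    it is determined modulo [L, M] because lifts differ by elements T t.

    Exactness is what remains of the same chase.  A cycle z of L that becomes a
    boundary in L/M is T t modulo a boundary of L, and psi kills t since z is a
    cycle.  If br y belongs to [L, M], say br y = br (T t), then y - T t is a
    cycle of L lifting the same cycle of L/M as y.  Perfectness of L says that br
    is onto, so that each m in M is br y for some y, whose image in /\^2 (L/M) is
    then a cycle: this gives surjectivity at the end of the sequence. *)

(** * Linear maps, free modules and exterior powers *)

Section LinearAlgebra.
Variables (K : fieldType).

Section Image.
Variables (U V : lmodType K) (f : {linear U -> V}).

Definition lin_im : {pred V} := fun v => `[< exists u, f u = v >].

Fact lin_im_submod : submod_closed lin_im.
Proof.
split=> [|a _ _ /asboolP[x <-] /asboolP[y <-]]; apply/asboolP.
  by exists 0; rewrite linear0.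
by exists (a *: x + y); rewrite linearP.
Qed.

HB.instance Definition _ := GRing.isSubmodClosed.Build K V lin_im lin_im_submod.

Lemma lin_imP v : reflect (exists u, f u = v) (v \in lin_im).
Proof. exact: asboolP. Qed.

Lemma mem_lin_im u : f u \in lin_im.
Proof. by apply/lin_imP; exists u. Qed.

End Image.

Lemma lpi_eq0 (V : lmodType K) (W : submodClosed V) v : (lpi W v = 0) <-> (v \in W).
Proof. by rewrite -[X in _ = X](linear0 (lpi W)) lpi_eq subr0. Qed.

Lemma lspan_eq0 (U V : lmodType K) (S : set U) (f : {linear U -> V}) :
  (forall u, S u -> f u = 0) -> forall u, u \in lspan S -> f u = 0.
Proof.
move=> fS u uS; apply/eqP; apply: (lspan_sub (W := lin_ker f) _ uS) => s /fS fs0.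
exact/eqP.
Qed.

(** The maps of the exact sequence all depend on the choice of a lift or of a
    representative.  Describing them by their graphs replaces well-definedness
    and linearity by closure of the graph under linear combinations, the only
    value related to 0 being 0; exactness can then be read on the graphs. *)
Lemma linear_of_graph (U V : lmodType K) (R : U -> V -> Prop) :
    (forall u, exists v, R u v) ->
    (forall a u u' v v', R u v -> R u' v' -> R (a *: u + u') (a *: v + v')) ->
    (forall v, R 0 v -> v = 0) ->
  exists f : {linear U -> V}, forall u v, f u = v <-> R u v.
Proof.
move=> /choice[f Rf] R_lin R0.
have Rinj u v v' : R u v -> R u v' -> v = v'.
  move=> Rv Rv'; apply/eqP; rewrite -subr_eq0; apply/eqP/R0.
  have := R_lin (-1) _ _ _ _ Rv' Rv.
  by rewrite !scaleN1r addNr [_ + v]addrC.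
have f_lin : linear f by move=> a u u'; apply: Rinj (Rf _) (R_lin _ _ _ _ _ _ _).
pose F : {linear U -> V} := HB.pack f (GRing.isLinear.Build K U V _ f f_lin).
by exists F => u v; split=> [<-|]; [apply: Rf|apply: Rinj].
Qed.

Lemma freeg_eq0 (T : choiceType) (V : lmodType K) (f : {linear {freeg T / K} -> V}) :
  (forall t, f (gen K t) = 0) -> forall v, f v = 0.
Proof.
move=> f0 v; rewrite -(freeg_sumE v) linear_sum big1 // => t _.
have -> : << coeff t v *g t >> = coeff t v *: gen K t.
  by apply/eqP/freeg_eqP => x; rewrite coeffZ !coeffU mul1r.
by rewrite linearZ /= f0 scaler0.
Qed.

Lemma ext_ind (V : lmodType K) n (W : submodClosed (ext V n)) :
  (forall x, wedge x \in W) -> forall v, v \in W.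
Proof.
move=> wedgeW v; rewrite -[v]lreprK; apply/lpi_eq0.
pose F : {linear {freeg {ffun 'I_n -> V} / K} -> lquot W} :=
  lpi W \o lpi (lspan (@ext_rel K V n)).
by apply: (@freeg_eq0 _ _ F) => x; apply/lpi_eq0/wedgeW.
Qed.

Lemma tensor_ind (U V : lmodType K) (W : submodClosed (tensor U V)) :
  (forall u v, tens u v \in W) -> forall t, t \in W.
Proof.
move=> tensW t; rewrite -[t]lreprK; apply/lpi_eq0.
pose F : {linear {freeg (U * V) / K} -> lquot W} :=
  lpi W \o lpi (lspan (@tensor_rel K U V)).
by apply: (@freeg_eq0 _ _ F) => -[u v]; apply/lpi_eq0/tensW.
Qed.

Lemma eq_ext (V W : lmodType K) n (f g : {linear ext V n -> W}) :
  (forall x, f (wedge x) = g (wedge x)) -> f =1 g.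
Proof.
move=> fg v; apply/eqP; rewrite -subr_eq0.
apply: (ext_ind (W := lin_ker (f \- g))) => x.
by rewrite unfold_in /lin_ker /= fg subrr.
Qed.

Lemma eq_tensor (U V W : lmodType K) (f g : {linear tensor U V -> W}) :
  (forall u v, f (tens u v) = g (tens u v)) -> f =1 g.
Proof.
move=> fg t; apply/eqP; rewrite -subr_eq0.
apply: (tensor_ind (W := lin_ker (f \- g))) => u v.
by rewrite unfold_in /lin_ker /= fg subrr.
Qed.

Section ExtMap.
Variables (U V : lmodType K) (f : {linear U -> V}) (n : nat).

Definition fam_map (x : {ffun 'I_n -> U}) : {ffun 'I_n -> V} := [ffun i => f (x i)].

Fact ext_map_linear x i a u v :
  wedge (fam_map (upd x i (a *: u + v)))
    = a *: wedge (fam_map (upd x i u)) + wedge (fam_map (upd x i v)).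
Proof.
have E w : fam_map (upd x i w) = upd (fam_map x) i (f w).
  by apply/ffunP => k; rewrite !ffunE; case: eqP.
by rewrite !E linearP wedge_linear.
Qed.

Fact ext_map_alternate (x : {ffun 'I_n -> U}) i j :
  i != j -> x i = x j -> wedge (fam_map x) = 0.
Proof. by move=> ij xij; apply: (wedge_alternate ij); rewrite !ffunE xij. Qed.

Definition ext_map : {linear ext U n -> ext V n} :=
  ext_lift ext_map_linear ext_map_alternate.

Lemma ext_mapE x : ext_map (wedge x) = wedge (fam_map x).
Proof. exact: ext_liftE. Qed.

Lemma ext_map_surj : (forall v, exists u, f u = v) ->
  forall w, exists z, ext_map z = w.
Proof.
move=> /choice[s sK] w; apply/lin_imP; apply: ext_ind => x.
apply/lin_imP; exists (wedge [ffun i => s (x i)]); rewrite ext_mapE.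
by congr wedge; apply/ffunP => i; rewrite !ffunE sK.
Qed.

End ExtMap.

(* Simplification would otherwise expose the free modules behind the universal
   property; the same applies to the other maps made opaque below. *)
Opaque ext_map.

Section ExteriorSquare.
Variable V : lmodType K.

(** The default value 0 of nth is only reached when s has less than n entries. *)
Definition fam (n : nat) (s : seq V) : {ffun 'I_n -> V} := [ffun i : 'I_n => s`_i].

Definition wedge2 (x y : V) : ext V 2 := wedge (fam 2 [:: x; y]).
Definition wedge3 (x y z : V) : ext V 3 := wedge (fam 3 [:: x; y; z]).

Lemma wedge_wedge2 (x : {ffun 'I_2 -> V}) : wedge x = wedge2 (x ord0) (x ord_max).
Proof.
congr wedge; apply/ffunP => -[[|[|//]] i2]; rewrite ffunE;
  by congr (x _); apply: val_inj.
Qed.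

Lemma wedge2xx x : wedge2 x x = 0.
Proof. by apply: (@wedge_alternate _ _ _ _ ord0 ord_max) => //; rewrite !ffunE. Qed.

Lemma wedge2_linearl y : linear (wedge2^~ y).
Proof.
move=> a u v; have E w : fam 2 [:: w; y] = upd (fam 2 [:: 0; y]) ord0 w.
  by apply/ffunP => -[[|[|//]] i2]; rewrite !ffunE.
by rewrite /wedge2 (E (a *: u + v)) (E u) (E v) wedge_linear.
Qed.

Lemma wedge2_linearr x : linear (wedge2 x).
Proof.
move=> a u v; have E w : fam 2 [:: x; w] = upd (fam 2 [:: x; 0]) ord_max w.
  by apply/ffunP => -[[|[|//]] i2]; rewrite !ffunE.
by rewrite /wedge2 (E (a *: u + v)) (E u) (E v) wedge_linear.
Qed.

HB.instance Definition _ x :=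
  GRing.isLinear.Build K V (ext V 2) _ (wedge2 x) (wedge2_linearr x).

Lemma wedge2Dl x x' y : wedge2 (x + x') y = wedge2 x y + wedge2 x' y.
Proof. by have := wedge2_linearl y 1 x x'; rewrite /= !scale1r. Qed.

Lemma wedge2C x y : wedge2 x y = - wedge2 y x.
Proof.
apply/eqP; rewrite -addr_eq0; apply/eqP; have := wedge2xx (x + y).
by rewrite wedge2Dl !linearD /= !wedge2xx add0r addr0.
Qed.

Lemma wedge2Bl x x' y : wedge2 (x - x') y = wedge2 x y - wedge2 x' y.
Proof. by rewrite wedge2C linearB /= wedge2C [wedge2 y x']wedge2C opprB opprK addrC. Qed.

Lemma wedge2Nl x y : wedge2 (- x) y = - wedge2 x y.
Proof. by rewrite wedge2C linearN /= wedge2C opprK wedge2C. Qed.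

Lemma wedge_wedge3 (x : {ffun 'I_3 -> V}) :
  wedge x = wedge3 (x ord0) (x (fintype.lift ord0 ord0)) (x ord_max).
Proof.
congr wedge; apply/ffunP => -[[|[|[|//]]] i3]; rewrite ffunE;
  by congr (x _); apply: val_inj.
Qed.

Section Lift.
Variables (W : lmodType K) (B : V -> V -> W).
Hypotheses (B_linearl : forall y, linear (B^~ y)) (B_linearr : forall x, linear (B x)).
Hypothesis Bxx : forall x, B x x = 0.

Fact ext2_lift_linear (x : {ffun 'I_2 -> V}) i a u v :
  B (upd x i (a *: u + v) ord0) (upd x i (a *: u + v) ord_max)
    = a *: B (upd x i u ord0) (upd x i u ord_max)
      + B (upd x i v ord0) (upd x i v ord_max).
Proof.
by case: i => -[|[|//]] i2; rewrite !ffunE /= ?B_linearr //; apply: B_linearl.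
Qed.

Fact ext2_lift_alternate (x : {ffun 'I_2 -> V}) i j :
  i != j -> x i = x j -> B (x ord0) (x ord_max) = 0.
Proof.
have E (x0 x1 : V) : x0 = x1 -> B x0 x1 = 0 by move=> ->.
case: i j => [[|[|//]] i2] [[|[|//]] j2] // _ xij; apply: E.
  by rewrite (_ : ord0 = Ordinal i2) ?xij; [congr (x _)|]; apply: val_inj.
by rewrite (_ : ord0 = Ordinal j2) -?xij; [congr (x _)|]; apply: val_inj.
Qed.

Definition ext2_lift : {linear ext V 2 -> W} :=
  ext_lift ext2_lift_linear ext2_lift_alternate.

Lemma ext2_liftE x y : ext2_lift (wedge2 x y) = B x y.
Proof. by rewrite [LHS]ext_liftE !ffunE. Qed.

End Lift.

End ExteriorSquare.

Opaque ext2_lift.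

Lemma ext_map_wedge2 (U V : lmodType K) (f : {linear U -> V}) x y :
  ext_map f 2 (wedge2 x y) = wedge2 (f x) (f y).
Proof. by rewrite ext_mapE wedge_wedge2 !ffunE. Qed.

Section RightExact.
Variables (A V U : lmodType K) (i : {linear A -> V}) (p : {linear V -> U}).

Fact tensor_wedge_linearl y : linear (fun a => wedge2 (i a) y).
Proof. by move=> c a b; rewrite linearP; apply: wedge2_linearl. Qed.

Fact tensor_wedge_linearr a : linear (wedge2 (i a)).
Proof. exact: wedge2_linearr. Qed.

Definition tensor_wedge : {linear tensor A V -> ext V 2} :=
  tensor_lift tensor_wedge_linearl tensor_wedge_linearr.

Lemma tensor_wedgeE a y : tensor_wedge (tens a y) = wedge2 (i a) y.
Proof. exact: tensor_liftE. Qed.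

Opaque tensor_wedge.

Hypotheses (p_surj : forall u, exists v, p v = u) (ip : exact_at i p).

(** A left inverse of /\^2 p modulo the image of T sends u /\ v to the class of
    x /\ y for any lifts x of u and y of v.  It is well defined since
    changing x by an element of A changes x /\ y by an element of the image. *)
Lemma ext2_right_exact : exact_at tensor_wedge (ext_map p 2).
Proof.
have pi0 a : p (i a) = 0 by apply/ip; exists a.
move=> z; split; last first.
  case=> t <-; move: t.
  apply: (eq_tensor (f := ext_map p 2 \o tensor_wedge) (g := \0)) => a y /=.
  by rewrite tensor_wedgeE ext_map_wedge2 pi0 wedge2C linear0 oppr0.
(* The section s need not be linear: Wl and Wr make its values irrelevant
   modulo W. *)
have [s sK] := choice p_surj.
pose W := lin_im tensor_wedge; pose B x y := lpi W (wedge2 (s x) (s y)).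
have Wl x x' y : p x = p x' -> lpi W (wedge2 x y) = lpi W (wedge2 x' y).
  move=> pxx'; apply/lpi_eq; rewrite -wedge2Bl.
  have /ip[a <-] : p (x - x') = 0 by rewrite linearB pxx' subrr.
  by rewrite -tensor_wedgeE mem_lin_im.
have Wr x y y' : p y = p y' -> lpi W (wedge2 x y) = lpi W (wedge2 x y').
  move=> pyy'; rewrite wedge2C [wedge2 x y']wedge2C !linearN; congr (- _).
  exact: Wl.
have Bl y : linear (B^~ y).
  move=> a u v; rewrite /B (Wl _ (a *: s u + s v)); last by rewrite linearP !sK.
  by rewrite wedge2_linearl linearP.
have Br x : linear (B x).
  move=> a u v; rewrite /B (Wr _ _ (a *: s u + s v)); last by rewrite linearP !sK.
  by rewrite wedge2_linearr linearP.
have Bxx x : B x x = 0 by rewrite /B wedge2xx linear0.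
have Bp : ext2_lift Bl Br Bxx \o ext_map p 2 =1 lpi W.
  apply: eq_ext => x; rewrite wedge_wedge2 /= ext_map_wedge2 ext2_liftE /B.
  by rewrite (Wl _ (x ord0)) ?sK // (Wr _ _ (x ord_max)) ?sK.
move=> pz0; apply/lin_imP/lpi_eq0.
by rewrite -Bp /= pz0 linear0.
Qed.

End RightExact.

Opaque tensor_wedge.

End LinearAlgebra.

(** * The Chevalley-Eilenberg complex in low degrees *)

Section Chains.
Variable K : fieldType.

Opaque hl_bound ext_map tensor_wedge.

Section Functoriality.
Variables (L L' : homLieType K) (f : {linear L -> L'}).
Hypotheses (f_br : forall x y, f {[x, y]} = {[f x, f y]})
  (f_alpha : forall x, f (hlalpha x) = hlalpha (f x)).

Lemma hl_bound_ext_map n w :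
  hl_bound L' n (ext_map f n.+1 w) = ext_map f n (hl_bound L n w).
Proof.
move: w; apply: (eq_ext (f := hl_bound L' n \o ext_map f n.+1)
                        (g := ext_map f n \o hl_bound L n)) => x /=.
rewrite ext_mapE !hl_boundE /hl_bound_fun linear_sum.
apply: eq_bigr => i _; rewrite linear_sum; apply: eq_bigr => j _.
rewrite linearZ /= ext_mapE; congr (_ *: wedge _); apply/ffunP => k.
by rewrite !ffunE; case: ifP => _; rewrite ?f_br ?f_alpha // !ffunE.
Qed.

End Functoriality.

Section LowDegrees.
Variable L : homLieType K.

Definition ext_br : {linear ext L 2 -> L} :=
  ext2_lift (@hlbr_linearl K L) (@hlbr_linearr K L) (@hlbrxx K L).

Lemma ext_brE x y : ext_br (wedge2 x y) = {[x, y]}.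
Proof. exact: ext2_liftE. Qed.

Opaque ext_br.

(** hl_bound L n is the boundary d_(n+1) out of degree n + 1.  In this cyclic
    form, the bracket maps d_3 (x /\ y /\ z) to the Hom-Jacobi sum. *)
Lemma hl_bound3E x y z :
  hl_bound L 2 (wedge3 x y z)
    = - (wedge2 {[x, y]} (hlalpha z) + wedge2 {[y, z]} (hlalpha x)
         + wedge2 {[z, x]} (hlalpha y)).
Proof.
have inordE k : (k < 3)%N -> @inord 2 k = k :> nat by move=> k3; rewrite inordK.
rewrite hl_boundE /hl_bound_fun !big_ord_recl big_ord0.
do 3!rewrite big_mkcond !big_ord_recl big_ord0 /=.
rewrite !wedge_wedge2 !ffunE /= !inordE //=.
(* Only the parities of the three sums i + j are left in the signs. *)
rewrite -!(signr_odd _ (_ + _)) /= !expr1 expr0 !scaleN1r scale1r !add0r !addr0.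
by rewrite [{[z, x]}]hlbrC wedge2Nl !opprD opprK addrAC.
Qed.

Lemma ext_br_bound w : ext_br (hl_bound L 2 w) = 0.
Proof.
move: w; apply: (eq_ext (f := ext_br \o hl_bound L 2) (g := \0)) => x /=.
rewrite wedge_wedge3 hl_bound3E linearN !linearD /= !ext_brE.
rewrite ![{[_, hlalpha _]}]hlbrC -!opprD opprK addrAC.
exact: hl_jacobi.
Qed.

Fact wedge1_linear : linear (fun x : L => wedge (fam 1 [:: x])).
Proof.
move=> a u v; have E (w : L) : fam 1 [:: w] = upd (fam 1 [:: 0]) ord0 w.
  by apply/ffunP => k; rewrite !ffunE ord1.
by rewrite (E (a *: u + v)) (E u) (E v) wedge_linear.
Qed.

Definition wedge1 : {linear L -> ext L 1} :=
  HB.pack (fun x : L => wedge (fam 1 [:: x]))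
    (GRing.isLinear.Build K L (ext L 1) _ _ wedge1_linear).

Lemma wedge1_inj x : wedge1 x = 0 -> x = 0.
Proof.
have ev_lin (y : {ffun 'I_1 -> L}) i a u v :
    upd y i (a *: u + v) ord0 = a *: upd y i u ord0 + upd y i v ord0.
  by rewrite !ffunE !ord1.
have ev_alt (y : {ffun 'I_1 -> L}) i j : i != j -> y i = y j -> y ord0 = 0.
  by rewrite !ord1.
move=> x0; have := ext_liftE ev_lin ev_alt (fam 1 [:: x]).
by rewrite -[wedge _]/(wedge1 x) x0 linear0 ffunE.
Qed.

Lemma hl_bound2E w : hl_bound L 1 w = - wedge1 (ext_br w).
Proof.
move: w; apply: (eq_ext (f := hl_bound L 1) (g := \- (wedge1 \o ext_br))) => x.
rewrite /= hl_boundE /hl_bound_fun !big_ord_recl big_ord0.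
do 2!rewrite big_mkcond !big_ord_recl big_ord0 /=.
rewrite !add0r !addr0 wedge_wedge2 ext_brE expr1 scaleN1r; congr (- wedge _).
apply/ffunP => k; rewrite !ord1 !ffunE /=.
by congr {[_, x _]}; apply: val_inj.
Qed.

Lemma cycle2E z : (z \in @hl_cycle K L 2) = (ext_br z == 0).
Proof.
rewrite [LHS]/(hl_bound L 1 z == 0) hl_bound2E.
apply/idP/idP => [/eqP brz0|/eqP->]; last by apply/eqP; rewrite linear0 oppr0.
by apply/eqP/wedge1_inj; rewrite -[LHS]opprK brz0 oppr0.
Qed.

(** Being a cycle is part of having a class; this relation lets homology classes
    be handled through chains, without subtypes or quotients. *)
Definition is_class (c : hl_homology L 2) (z : ext L 2) : Prop :=
  exists2 zc : subsp (@hl_cycle K L 2), lpi (@hl_boundary K L 2) zc = c & val zc = z.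

Lemma is_class_rep c : exists z, is_class c z.
Proof. by exists (val (lrepr c)), (lrepr c); rewrite ?lreprK. Qed.

Lemma is_class_br c z : is_class c z -> ext_br z = 0.
Proof. by case=> zc _ <-; apply/eqP; rewrite -cycle2E; apply: valP. Qed.

Lemma is_class_ex z : ext_br z = 0 -> exists c, is_class c z.
Proof.
move=> /eqP; rewrite -cycle2E => zc.
by exists (lpi _ (Sub z zc : subsp (@hl_cycle K L 2))), (Sub z zc).
Qed.

Lemma is_class_linear a c c' z z' :
  is_class c z -> is_class c' z' -> is_class (a *: c + c') (a *: z + z').
Proof.
by move=> [x <- <-] [x' <- <-]; exists (a *: x + x'); rewrite linearP.
Qed.

(** From right to left this uses that boundaries are cycles. *)
Lemma is_class0 z : is_class 0 z <-> exists w, hl_bound L 2 w = z.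
Proof.
split=> [[zc /lpi_eq0/asboolP[w ww] <-]|[w ww]]; first by exists w.
have [c [zc zcE zcz]] : exists c, is_class c z.
  by apply: is_class_ex; rewrite -ww ext_br_bound.
exists zc => //; apply/lpi_eq0/asboolP.
by exists w; rewrite ww.
Qed.

Lemma is_class_bound c z w : is_class c z -> is_class c (z - hl_bound L 2 w).
Proof.
move=> cz; have /is_class0 w0 : exists v, hl_bound L 2 v = - hl_bound L 2 w.
  by exists (- w); rewrite linearN.
by have := is_class_linear 1 cz w0; rewrite !scale1r addr0.
Qed.

Lemma is_class_uniq c c' z : is_class c z -> is_class c' z -> c = c'.
Proof.
by move=> [x <- xz] [x' <- x'z]; congr lpi; apply: val_inj; rewrite xz x'z.
Qed.

Local Notation B2 := (lin_im (hl_bound L 2)).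

Lemma bound_jacobi (x y z : L) :
  wedge2 {[x, y]} (hlalpha z) + wedge2 {[y, z]} (hlalpha x)
    + wedge2 {[z, x]} (hlalpha y) \in B2.
Proof. by apply/lin_imP; exists (- wedge3 x y z); rewrite linearN hl_bound3E opprK. Qed.

(** Up to antisymmetry, the relations (a), (b) and (e) of the star product are
    values of d_3. *)
Lemma bound_rel_a (x y z : L) :
  wedge2 {[x, y]} (hlalpha z) - wedge2 (hlalpha x) {[y, z]}
    + wedge2 (hlalpha y) {[x, z]} \in B2.
Proof.
have := bound_jacobi x y z.
by rewrite [wedge2 (hlalpha x) _]wedge2C opprK [wedge2 (hlalpha y) _]wedge2C
           -wedge2Nl -hlbrC.
Qed.

Lemma bound_rel_b (x y z : L) :
  wedge2 (hlalpha x) {[y, z]} - wedge2 {[z, x]} (hlalpha y)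
    + wedge2 {[y, x]} (hlalpha z) \in B2.
Proof.
have := bound_jacobi y z x; rewrite -rpredN !opprD -!wedge2C.
rewrite [wedge2 (hlalpha z) _]wedge2C -[- wedge2 {[x, y]} _]wedge2Nl -[- {[x, y]}]hlbrC.
by rewrite [wedge2 (hlalpha x) _ + _]addrC addrAC.
Qed.

(** The relations (c) and (d) involve [x, z] = - [z, x] only, so antisymmetry
    suffices. *)
Lemma wedge_rel_c (x z : L) : wedge2 {[z, x]} {[x, z]} = 0.
Proof. by rewrite [{[x, z]}]hlbrC linearN /= wedge2xx oppr0. Qed.

Lemma wedge_rel_d (x y z t : L) :
  wedge2 {[z, x]} {[y, t]} + wedge2 {[t, y]} {[x, z]} = 0.
Proof.
rewrite [{[y, t]}]hlbrC [{[x, z]}]hlbrC !linearN /=.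
by rewrite [wedge2 {[t, y]} _]wedge2C opprK addNr.
Qed.

(** With X = [x', x], Y = [y', y] and Z = [z', z], this is minus the Jacobi
    boundary of X, Y, Z, because [z, z'] = - Z and similarly for x and y. *)
Lemma bound_rel_e (x y z x' y' z' : L) :
  wedge2 {[{[x', x]}, {[y', y]}]} (hlalpha {[z, z']})
    + wedge2 {[{[y', y]}, {[z', z]}]} (hlalpha {[x, x']})
    + wedge2 {[{[z', z]}, {[x', x]}]} (hlalpha {[y, y']}) \in B2.
Proof.
rewrite [{[x, x']}]hlbrC [{[y, y']}]hlbrC [{[z, z']}]hlbrC.
rewrite !linearN /= -!opprD rpredN; exact: bound_jacobi.
Qed.

End LowDegrees.

(** * The complex of an ideal and of its quotient *)

Section Ideal.
Variables (L : homLieType K) (M : homIdeal L).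

Local Notation MM := (ideal_alg M).
Local Notation i := (@ideal_val K L M : {linear MM -> L}).
Local Notation p := (@quot_pi K L M : {linear L -> quot_alg M}).
Local Notation B2 := (lin_im (hl_bound L 2)).
Local Notation T := (@tensor_wedge K MM L i).
Local Notation p2 := (ext_map p 2).

Opaque psi_tensor ext_br.

Lemma quot_pi_surj u : exists x, p x = u.
Proof. by have [x ->] := quot_reprE u; exists x. Qed.

Lemma ideal_exact : exact_at i p.
Proof.
move=> x; rewrite /= /quot_pi lpi_eq0; split=> [xM|[m <-]]; last exact: valP.
by exists (ideal_mk xM).
Qed.

Lemma wedge_ideal_exact : exact_at T p2.
Proof. exact: ext2_right_exact quot_pi_surj ideal_exact. Qed.

Lemma quot_bound n w :
  hl_bound (quot_alg M) n (ext_map p n.+1 w) = ext_map p n (hl_bound L n w).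
Proof.
apply: hl_bound_ext_map => [x y|x]; apply: esym.
  exact: quot_hlbrE.
exact: quot_hlalphaE.
Qed.

Lemma quot_ext_br z : ext_br _ (p2 z) = p (ext_br _ z).
Proof.
move: z; apply: (eq_ext (f := ext_br _ \o p2) (g := p \o ext_br _)) => x /=.
by rewrite wedge_wedge2 ext_map_wedge2 !ext_brE; apply: quot_hlbrE.
Qed.

Lemma ext_br_tensor_wedge t : ext_br L (T t) = i (psi_tensor M t).
Proof.
move: t; apply: (eq_tensor (f := ext_br L \o T) (g := i \o psi_tensor M)) => m l.
by rewrite /= tensor_wedgeE ext_brE psi_tensorE.
Qed.

(** This is why m * l |-> m /\ l is well defined from the star product to the
    exterior square modulo boundaries. *)
Lemma star_rel_bound t : t \in lspan (star_rel (ideal_actl M) (ideal_actr M)) ->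
  T t \in B2.
Proof.
pose F : {linear tensor MM L -> lquot B2} := lpi B2 \o T.
suff FR s : star_rel (ideal_actl M) (ideal_actr M) s -> F s = 0.
  by move=> /(lspan_eq0 FR)/lpi_eq0.
move=> sR; apply/lpi_eq0.
case: s / sR => [m m' l|m l l'|m l|m m' l l'|m m' m'' l l' l''];
  rewrite ?linearD ?linearN /= ?linearN !tensor_wedgeE.
- exact: bound_rel_a.
- exact: bound_rel_b.
- by rewrite [wedge2 _ _]wedge_rel_c rpred0.
- by rewrite [X in X \in _]wedge_rel_d rpred0.
- exact: bound_rel_e.
Qed.

(** [L, M] is the image of m (x) l |-> [m, l]: a sign can be absorbed in m, so
    the generators [l, m] already span this image. *)
Lemma ideal_coinv_eq0 m :
  lpi _ m = 0 :> ideal_coinv M <-> exists t, psi_tensor M t = m.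
Proof.
rewrite lpi_eq0; split.
  move=> mLM; apply/lin_imP; apply: lspan_sub mLM => _ [l [m' ->]].
  apply/lin_imP; exists (- tens m' l); apply: ideal_val_inj.
  by rewrite !linearN /= psi_tensorE hlbrC opprK.
case=> t <-; apply/lpi_eq0; move: t.
apply: (eq_tensor (f := lpi _ \o psi_tensor M) (g := \0)) => m' l /=.
apply/lpi_eq0.
have -> : psi_tensor M (tens m' l) = ideal_actr M l (- m').
  by apply: ideal_val_inj; rewrite psi_tensorE hlbrC -hlbrNr.
by apply: mem_lspan; exists l, (- m').
Qed.

End Ideal.

End Chains.

(** * The exact sequence *)

Section Sequence.
Variables (K : fieldType) (L : homLieType K) (M : homIdeal L).

Local Notation MM := (ideal_alg M).
Local Notation Q := (quot_alg M).
Local Notation i := (@ideal_val K L M : {linear MM -> L}).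
Local Notation p := (@quot_pi K L M : {linear L -> Q}).
Local Notation T := (@tensor_wedge K MM L i).
Local Notation p2 := (ext_map p 2).
Local Notation star_pi := (lpi (lspan (star_rel (ideal_actl M) (ideal_actr M)))).

Opaque psi_tensor psi ext_br hl_bound ext_map tensor_wedge.

Definition ker_to_H2 (k : subsp (lin_ker (psi M))) (c : hl_homology L 2) : Prop :=
  exists2 t, star_pi t = val k & is_class c (T t).

Definition H2_to_H2 (c : hl_homology L 2) (c' : hl_homology Q 2) : Prop :=
  exists2 z, is_class c z & is_class c' (p2 z).

Definition H2_to_coinv (c : hl_homology Q 2) (w : ideal_coinv M) : Prop :=
  exists y m, [/\ is_class c (p2 y), i m = ext_br L y & w = lpi _ m].

Lemma psi_star_pi t : psi M (star_pi t) = psi_tensor M t.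
Proof. exact: lquot_liftE. Qed.

Lemma ker_to_H2_fun :
  exists f : {linear subsp (lin_ker (psi M)) -> hl_homology L 2},
    forall k c, f k = c <-> ker_to_H2 k c.
Proof.
apply: linear_of_graph => [k|a k k' c c' [t tk ct] [t' tk' ct']|c [t t0 ct]].
- have [c ct] : exists c, is_class c (T (lrepr (val k))).
    apply: is_class_ex; rewrite ext_br_tensor_wedge -psi_star_pi lreprK.
    by have /eqP-> := valP k; rewrite linear0.
  by exists c, (lrepr (val k)); rewrite ?lreprK.
- exists (a *: t + t'); first by rewrite lpi_linear tk tk'.
  by rewrite linearP; apply: is_class_linear.
- move/lpi_eq0/star_rel_bound/lin_imP/is_class0: t0.
  exact: is_class_uniq.
Qed.

Lemma H2_to_H2_fun : exists g : {linear hl_homology L 2 -> hl_homology Q 2},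
  forall c c', g c = c' <-> H2_to_H2 c c'.
Proof.
apply: linear_of_graph => [c|a c1 c2 c1' c2' [z cz cz'] [y cy cy']|c [z cz cz']].
- have [z cz] := is_class_rep c.
  have [c' cz'] : exists c', is_class c' (p2 z).
    by apply: is_class_ex; rewrite quot_ext_br (is_class_br cz) linear0.
  by exists c', z.
- by exists (a *: z + y); rewrite ?linearP; apply: is_class_linear.
- have [w wz] := (is_class0 z).1 cz; apply: is_class_uniq cz' _.
  by apply/is_class0; exists (ext_map p 3 w); rewrite quot_bound wz.
Qed.

(** If the chain y lies over a boundary of L/M, then, once that boundary is lifted
    and removed, y is in the image of T: this is why the value lies in [L, M]. *)
Lemma H2_to_coinv_fun : exists h : {linear hl_homology Q 2 -> ideal_coinv M},
  forall c w, h c = w <-> H2_to_coinv c w.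
Proof.
apply: linear_of_graph => [c|a c c' w w' [y [m [cy my ->]]] [y' [m' [cy' my' ->]]]|].
- have [z cz] := is_class_rep c.
  have [y yz] := ext_map_surj (n := 2) (@quot_pi_surj _ _ M) z.
  have /ideal_exact[m my] : p (ext_br L y) = 0.
    by rewrite -quot_ext_br yz (is_class_br cz).
  by exists (lpi _ m), y, m; rewrite yz.
- exists (a *: y + y'), (a *: m + m'); split; last by rewrite linearP.
    by rewrite linearP; apply: is_class_linear.
  by rewrite !linearP my my'.
- move=> w [y [m [/is_class0[w' w'y] my ->]]].
  have [v vw'] := ext_map_surj (n := 3) (@quot_pi_surj _ _ M) w'.
  have /wedge_ideal_exact[t tE] : p2 (y - hl_bound L 2 v) = 0.
    by rewrite linearB -quot_bound vw' w'y subrr.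
  apply/ideal_coinv_eq0; exists t; apply: ideal_val_inj.
  by rewrite -ext_br_tensor_wedge tE linearB ext_br_bound subr0 my.
Qed.

(** Lifting to L a chain whose boundary is the image of z, and subtracting the
    boundary of this lift from z, gives a cycle of the form T t in the class c. *)
Lemma H2_to_H2_ker c : H2_to_H2 c 0 <-> exists k, ker_to_H2 k c.
Proof.
split=> [[z cz /is_class0[w' w'z]]|[k [t tk ct]]].
  have [v vw'] := ext_map_surj (n := 3) (@quot_pi_surj _ _ M) w'.
  have /wedge_ideal_exact[t tE] : p2 (z - hl_bound L 2 v) = 0.
    by rewrite linearB -quot_bound vw' w'z subrr.
  have tK : star_pi t \in lin_ker (psi M).
    apply/eqP; rewrite psi_star_pi; apply: ideal_val_inj.
    rewrite -ext_br_tensor_wedge tE linearB ext_br_bound (is_class_br cz).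
    by rewrite subr0 linear0.
  exists (Sub (star_pi t) tK); exists t => //.
  by rewrite tE; apply: is_class_bound.
exists (T t) => //; apply/is_class0; exists 0.
by rewrite linear0; apply/esym/wedge_ideal_exact; exists t.
Qed.

(** A lift y with br y in [L, M] can be corrected by an element T t, invisible
    in L/M, into a cycle. *)
Lemma H2_to_coinv_ker c : H2_to_coinv c 0 <-> exists c', H2_to_H2 c' c.
Proof.
split=> [[y [m [cy my /esym/ideal_coinv_eq0[t tm]]]]|[c' [z cz cz']]].
  have Tt0 : p2 (T t) = 0 by apply/wedge_ideal_exact; exists t.
  have [c' cz] : exists c', is_class c' (y - T t).
    by apply: is_class_ex; rewrite linearB ext_br_tensor_wedge tm my subrr.
  by exists c', (y - T t) => //; rewrite linearB Tt0 subr0.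
by exists z, 0; rewrite !linear0 (is_class_br cz).
Qed.

Lemma perfect_ext_br_surj : perfect L -> forall x, exists y, ext_br L y = x.
Proof.
move=> perfL x; apply/lin_imP; apply: lspan_sub (perfL x) => _ [a [b ->]].
by rewrite -ext_brE mem_lin_im.
Qed.

Lemma H2_to_coinv_onto : perfect L -> forall w, exists c, H2_to_coinv c w.
Proof.
move=> perfL w; pose m : MM := lrepr w.
have [y ym] := perfect_ext_br_surj perfL (i m).
have [c cy] : exists c, is_class c (p2 y).
  by apply: is_class_ex; rewrite quot_ext_br ym; apply/ideal_exact; exists m.
by exists c, y, m; rewrite ym /m lreprK.
Qed.

End Sequence.

Theorem theorem2p16 (K : fieldType) (L : homLieType K) (M : homIdeal L)
    (L_perfect : perfect L) :
  exists (f : {linear subsp (lin_ker (psi M)) -> hl_homology L 2})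
         (g : {linear hl_homology L 2 -> hl_homology (quot_alg M) 2})
         (h : {linear hl_homology (quot_alg M) 2 -> ideal_coinv M}),
    [/\ exact_at f g, exact_at g h & forall w : ideal_coinv M, exists v, h v = w].
Proof.
have [f fE] := ker_to_H2_fun M.
have [g gE] := H2_to_H2_fun M.
have [h hE] := H2_to_coinv_fun M.
exists f, g, h; split=> [c|c|w].
- rewrite gE H2_to_H2_ker.
  by split=> -[k] /fE; exists k.
- rewrite hE H2_to_coinv_ker.
  by split=> -[c'] /gE; exists c'.
- by have [c /hE cw] := H2_to_coinv_onto L_perfect w; exists c.
Qed.
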